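(* For every $n$ there exists a 2-CNF formula $\phi$ in $n$ variables such that the satisfiability polytope of $\phi$ has extension complexity at least $2^{\Omega(\sqrt[4]{n})}$.
   Context: For a CNF formula $\phi$ in variables $x_1,\dots,x_n$, the satisfiability polytope of $\phi$ is the convex hull in $\mathbb{R}^n$ of all 0/1 vectors that are satisfying assignments of $\phi$. A 2-CNF (2-SAT) formula is a conjunction of clauses each a disjunction of at most two literals. The extension complexity $\mathrm{xc}(Q)$ of a polytope $Q$ is the minimum number of facets of a polytope $Q'$ such that $Q$ is a linear image of $Q'$. *)

(* Defs.v *)
From mathcomp Require Import all_boot.
From Stdlib Require Import Reals.
Set Implicit Arguments. Unset Strict Implicit. Unset Printing Implicit Defensive.
Local Open Scope R_scope.

Definition vec (m : nat) := 'I_m -> R.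
Definition vadd (m : nat) (x y : vec m) : vec m := fun i => x i + y i.
Definition vscale (m : nat) (t : R) (x : vec m) : vec m := fun i => t * x i.

Definition convex_set (m : nat) (C : vec m -> Prop) : Prop :=
  forall (x y : vec m) (t : R), C x -> C y -> 0 <= t <= 1 ->
    C (vadd (vscale t x) (vscale (1 - t) y)).

Definition conv_hull (m : nat) (S : vec m -> Prop) : vec m -> Prop :=
  fun x => forall C : vec m -> Prop, convex_set C ->
    (forall y, S y -> C y) -> C x.

Definition is_polytope (m : nat) (P : vec m -> Prop) : Prop :=
  exists (k : nat) (v : nat -> vec m), forall x,
    P x <-> conv_hull (fun y => exists i, (i < k)%coq_nat /\ forall j, y j = v i j) x.

Definition is_linear (m n : nat) (L : vec m -> vec n) : Prop :=
  (forall x y i, L (vadd x y) i = L x i + L y i) /\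
  (forall t x i, L (vscale t x) i = t * L x i).
Definition is_linear_functional (m : nat) (f : vec m -> R) : Prop :=
  (forall x y, f (vadd x y) = f x + f y) /\
  (forall t x, f (vscale t x) = t * f x).

Definition is_face (m : nat) (P F : vec m -> Prop) : Prop :=
  exists (f : vec m -> R) (beta : R), is_linear_functional f /\
    (forall x, P x -> f x <= beta) /\
    (forall x, F x <-> (P x /\ f x = beta)).

Definition is_facet (m : nat) (P F : vec m -> Prop) : Prop :=
  is_face P F /\ (exists x, F x) /\ ~ (forall x, F x <-> P x) /\
  forall G, is_face P G -> (forall x, F x -> G x) ->
    (forall x, G x <-> F x) \/ (forall x, G x <-> P x).

(* xc(Q) >= N : every polytope Q' (in any R^m) with a linear image equal to Q
   has at least N facets (facets counted as distinct sets: any enumeration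
   Fs 0, ..., Fs (k-1) covering all facets has k >= N). *)
Definition xc_ge (n : nat) (Q : vec n -> Prop) (N : R) : Prop :=
  forall (m : nat) (P : vec m -> Prop) (L : vec m -> vec n),
    is_polytope P -> is_linear L ->
    (forall y, Q y <-> exists x, P x /\ forall i, L x i = y i) ->
    forall (k : nat) (Fs : nat -> vec m -> Prop),
      (forall F, is_facet P F ->
         exists j, (j < k)%coq_nat /\ forall x, F x <-> Fs j x) ->
      N <= INR k.

(* literal (i, true) = x_i, (i, false) = not x_i *)
Definition literal (n : nat) := ('I_n * bool)%type.
Definition clause (n : nat) := seq (literal n).
Definition cnf (n : nat) := seq (clause n).

Definition is_2cnf (n : nat) (phi : cnf n) : bool :=
  all (fun c : clause n => leq (size c) 2) phi.

Definition lit_holds (n : nat) (a : 'I_n -> bool) (l : literal n) : bool :=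
  a l.1 == l.2.
Definition satisfies (n : nat) (a : 'I_n -> bool) (phi : cnf n) : bool :=
  all (fun c : clause n => has (lit_holds a) c) phi.

Definition sat_polytope (n : nat) (phi : cnf n) : vec n -> Prop :=
  conv_hull (fun y => exists a : 'I_n -> bool,
    satisfies a phi /\ forall i, y i = (if a i then 1 else 0)).

(* Main.v *)
(** Every face of a polytope is the intersection of the facets containing it, so
    if Q is a linear image of a polytope with N facets, the support of any slack
    matrix of Q is covered by N rectangles.  For the formula with clauses
    [~u_ij \/ y_i] and [~u_ij \/ ~y_j], the quantity [y_i - u_ij] dominates
    [y_i y_j], with equality when [u_ij = y_i /\ ~y_j]; this makes the inequality
    [(1 - \sum_(i in a) y_i)^2 >= 0] linear, and the entry of the resulting slack
    matrix at (a, b) is [(1 - |a :&: b|)^2].  Its support is the unique disjointness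
    pattern, for which Kaibel and Weltge show that a rectangle contains at most 2^k
    of the 3^k disjoint pairs, whence N >= (3/2)^k with O(k^2) variables. *)

Require Import Defs.
From Stdlib Require Import Reals Lra Classical ClassicalEpsilon FunctionalExtensionality.
From HB Require Import structures.
From mathcomp Require Import all_boot zify.
Set Implicit Arguments. Unset Strict Implicit. Unset Printing Implicit Defensive.
Local Open Scope R_scope.

(** * Linear functionals on convex hulls *)

Lemma conv_hull_le {m} (S : vec m -> Prop) (f : vec m -> R) (beta : R) :
  is_linear_functional f -> (forall y, S y -> f y <= beta) ->
  forall x, conv_hull S x -> f x <= beta.
Proof.
move=> [fD fZ] fS x hx; apply: (hx (fun y => f y <= beta)) => // y z t fy fz [t0 t1].
rewrite fD !fZ.
have ? : t * f y <= t * beta by apply: Rmult_le_compat_l.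
have ? : (1 - t) * f z <= (1 - t) * beta by apply: Rmult_le_compat_l; lra.
lra.
Qed.

Lemma real_argmin {T : finType} (A : {set T}) (F : T -> R) :
  A != set0 -> exists2 i, i \in A & forall j, j \in A -> F i <= F j.
Proof.
have [n] := ubnP #|A|; elim: n => // n IHn in A * => leAn /set0Pn [i Ai].
have [A0|/IHn [|j]] := eqVneq (A :\ i) set0.
- exists i => // j Aj; suff -> : j = i by lra.
  by have := in_set0 j; rewrite -A0 !inE Aj andbT => /negbFE /eqP.
- by rewrite (cardsD1 i A) Ai in leAn.
- rewrite !inE => /andP [_ Aj] minj.
  have [ij|ji] := Rle_lt_dec (F i) (F j); [exists i|exists j] => // l Al;
    have [->|li] := eqVneq l i; try lra.
  + by apply: (Rle_trans _ _ _ ij); apply: minj; rewrite !inE li.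
  + by apply: minj; rewrite !inE li.
Qed.

Lemma linear_functional_comb {m} (f g : vec m -> R) (s t : R) :
  is_linear_functional f -> is_linear_functional g ->
  is_linear_functional (fun x => s * f x + t * g x).
Proof.
by move=> [fD fZ] [gD gZ]; split=> *; rewrite ?fD ?gD ?fZ ?gZ; ring.
Qed.

(** * Separating a point from a face of a polytope by a facet *)

Section Facets.
Variables (m k : nat) (P : vec m -> Prop) (v : 'I_k -> vec m).
Hypothesis Pv : forall i, P (v i).
(** Expresses, for linear inequalities, that [P] lies in the hull of the [v i]: validity need only
    be checked at these points. *)
Hypothesis P_le : forall (f : vec m -> R) (beta : R), is_linear_functional f ->
  (forall i, f (v i) <= beta) -> forall x, P x -> f x <= beta.

(** The generators where the inequality is strict; their number is the measure for the induction on
    faces. *)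
Definition off_face (f : vec m -> R) (beta : R) : {set 'I_k} :=
  [set i | if Rlt_dec (f (v i)) beta then true else false].

Lemma off_faceP f beta i : reflect (f (v i) < beta) (i \in off_face f beta).
Proof. by rewrite inE; case: Rlt_dec => ?; constructor. Qed.

Lemma off_face_neq0 f beta x : is_linear_functional f ->
  (forall y, P y -> f y <= beta) -> P x -> f x < beta -> off_face f beta != set0.
Proof.
move=> lf fP Px fx; apply/negP => /eqP off0.
suff : - 1 * f x + 0 * f x <= - beta by lra.
apply: (P_le (linear_functional_comb (-1) 0 lf lf)) Px => i.
have : ~ f (v i) < beta by move/off_faceP; rewrite off0 inE.
lra.
Qed.

(** If [f] is not tight at [x], let [t] be the largest ratio of the slack of [f] to that of [g] over
    [off_face f beta]. Then the slack of [f] is at most [t] times that of [g] at all generators,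
    hence on [P], so it vanishes wherever the slack of [g] does. *)
Lemma face_sub_of_off_face f beta g gamma :
  is_linear_functional f -> (forall y, P y -> f y <= beta) ->
  is_linear_functional g -> (forall y, P y -> g y <= gamma) ->
  off_face f beta \subset off_face g gamma ->
  forall x, P x -> g x = gamma -> f x = beta.
Proof.
move=> lf fP lg gP /subsetP fg x Px gx.
case: (Req_dec (f x) beta) => // fx.
have fx_lt : f x < beta by have := fP _ Px; lra.
have [i gi maxi] :=
  real_argmin (fun i => - ((beta - f (v i)) / (gamma - g (v i))))
    (off_face_neq0 lf fP Px fx_lt).
set t := (beta - f (v i)) / (gamma - g (v i)) in maxi.
have t_pos : 0 < t.
  move/off_faceP: (gi) => ?; move/off_faceP: (fg _ gi) => ?.
  by apply: Rdiv_lt_0_compat; lra.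
suff : - 1 * f x + t * g x <= t * gamma - beta by rewrite gx; lra.
apply: (P_le (linear_functional_comb (-1) t lf lg)) Px => j.
have fj := fP _ (Pv j); have gj := gP _ (Pv j).
have [/[dup] fj' /off_faceP fj_lt|/off_faceP fj_ge] := boolP (j \in off_face f beta).
- have /off_faceP gj_lt := fg _ fj'.
  have := maxi j fj'; rewrite -/t => tj.
  have -> : f (v j) = beta - (beta - f (v j)) / (gamma - g (v j)) * (gamma - g (v j)).
    by field; lra.
  have := Rmult_le_compat_r (gamma - g (v j)) _ _ _ (Ropp_le_cancel _ _ tj).
  lra.
- have : 0 <= t * (gamma - g (v j)) by apply: Rmult_le_pos; lra.
  lra.
Qed.

(* If G is a face missing p but not a facet, take a larger proper face H.  If
   p is not in H, replace G by H; otherwise subtract from the slack of G the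
   largest multiple of the slack of H that leaves it nonnegative on P. *)
Lemma facet_separation g gamma p :
  is_linear_functional g -> (forall x, P x -> g x <= gamma) ->
  (exists x, P x /\ g x = gamma) -> P p -> g p < gamma ->
  exists G, [/\ is_facet P G, forall x, P x -> g x = gamma -> G x & ~ G p].
Proof.
have [n] := ubnP #|off_face g gamma|.
elim: n => // n IHn in g gamma * => leN lg gP [x0 [Px0 gx0]] Pp gp.
have [facet|not_facet] := classic (is_facet P (fun x => P x /\ g x = gamma)).
  by exists (fun x => P x /\ g x = gamma); split=> // -[_]; lra.
have [H [[h [eta [lh [hP HE]]]] [gH [Hg HP]]]] : exists H, is_face P H /\
    (forall x, P x -> g x = gamma -> H x) /\
    ~ (forall x, H x <-> P x /\ g x = gamma) /\ ~ (forall x, H x <-> P x).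
  apply: NNPP => noH; apply: not_facet; split; first by exists g, gamma.
  split; first by exists x0.
  split; first by move=> GP; have [_] := (GP p).2 Pp; lra.
  move=> H faceH gH; apply: NNPP => /not_or_and [H1 H2].
  by apply: noH; exists H; split=> //; split=> // x Px gx; apply: gH.
have {}gH x : P x -> g x = gamma -> h x = eta by move=> Px /(gH _ Px)/HE[].
have hg : off_face h eta \subset off_face g gamma.
  apply/subsetP => i /off_faceP hi; apply/off_faceP.
  have := gP _ (Pv i); case: (Req_dec (g (v i)) gamma) => [/(gH _ (Pv i))|]; lra.
have [hp|hp] : h p < eta \/ h p = eta by have := hP _ Pp; lra.
  (* Equal sets of off-face generators would make [H] the face of [g], so passing to [H] strictly
     lowers the measure. *)
  have [gh|gh] := boolP (off_face g gamma \subset off_face h eta).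
    case: Hg => x; rewrite HE; split=> -[Px] => [hx|/(gH _ Px) //].
    by split=> //; apply: (face_sub_of_off_face lg gP lh hP gh).
  have [||G [facetG hG Gp]] := IHn h eta _ lh hP _ Pp hp.
  - by rewrite ltnS in leN; apply: leq_trans leN; apply: proper_card; rewrite properE hg.
  - by exists x0; split=> //; apply: gH.
  - by exists G; split=> // x Px /(gH _ Px); apply: hG.
have [q [Pq hq]] : exists q, P q /\ h q < eta.
  apply: NNPP => noq; apply: HP => x; rewrite HE; split=> [[]//|Px]; split=> //.
  have := hP _ Px; case: (Rle_lt_dec eta (h x)) => [|hx]; first lra.
  by case: noq; exists x.
have [i hi mini] := real_argmin (fun i => (gamma - g (v i)) / (eta - h (v i)))
    (off_face_neq0 lh hP Pq hq).
set t := (gamma - g (v i)) / (eta - h (v i)) in mini.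
have t_pos : 0 < t.
  move/off_faceP: (hi) => ?; move/off_faceP: (subsetP hg _ hi) => ?.
  by apply: Rdiv_lt_0_compat; lra.
have lf := linear_functional_comb 1 (- t) lg lh.
have fP x : P x -> 1 * g x + - t * h x <= gamma - t * eta.
  apply: (P_le lf) => j; have gj := gP _ (Pv j); have hj := hP _ (Pv j).
  have [hj'|/off_faceP hj'] := boolP (j \in off_face h eta); last first.
    have -> : h (v j) = eta by lra.
    lra.
  have := mini j hj'; rewrite -/t => tj.
  move/off_faceP: hj' => hj'.
  have -> : g (v j) = gamma - (gamma - g (v j)) / (eta - h (v j)) * (eta - h (v j)).
    by field; lra.
  have := Rmult_le_compat_r (eta - h (v j)) _ _ _ tj.
  lra.
(* Generator [i], where the ratio is minimal, has moved onto the new face, so the measure drops; the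
   slack at [p] is unchanged because [h p = eta]. *)
have [|||G [facetG fG Gp]] := IHn _ (gamma - t * eta) _ lf fP _ Pp _.
- rewrite ltnS in leN; apply: leq_trans leN; apply: proper_card; apply/properP; split.
    apply/subsetP => j /off_faceP fj; apply/off_faceP.
    have : 0 <= t * (eta - h (v j)).
      by apply: Rmult_le_pos; [lra|have := hP _ (Pv j); lra].
    lra.
  exists i; first exact: (subsetP hg).
  apply/off_faceP; move/off_faceP: hi => hi.
  have : t * (eta - h (v i)) = gamma - g (v i) by rewrite /t; field; lra.
  lra.
- by exists x0; split=> //; rewrite gx0 (gH _ Px0 gx0); ring.
- by rewrite hp; lra.
- by exists G; split=> // x Px gx; apply: fG => //; rewrite gx (gH _ Px gx); ring.
Qed.

End Facets.

(** * From facets of an extension to rectangle covers *)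

Lemma polytope_facet_separation {m} (P : vec m -> Prop) (f : vec m -> R) (beta : R) p :
  is_polytope P -> is_linear_functional f -> (forall x, P x -> f x <= beta) ->
  (exists x, P x /\ f x = beta) -> P p -> f p < beta ->
  exists G, [/\ is_facet P G, forall x, P x -> f x = beta -> G x & ~ G p].
Proof.
move=> [k [v PE]]; apply: (@facet_separation m k P (fun i => v i)) => [i|g gamma lg gv x].
  by apply/PE => C _; apply; exists i; split=> //; apply/ltP.
move=> /PE; apply: conv_hull_le lg _ x => y [i [/ltP ik yE]].
have -> : y = v i by apply: functional_extensionality.
exact: (gv (Ordinal ik)).
Qed.

(* Row a meets the j-th rectangle when the j-th facet contains the preimage of
   the face cut out by f a, column b when some lift of q b avoids that facet. *)
Lemma extension_rectangle_cover {n m} (Q : vec n -> Prop) (P : vec m -> Prop)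
    (L : vec m -> vec n) k (Fs : nat -> vec m -> Prop) {A B : Type}
    (f : A -> vec n -> R) (beta : A -> R) (q : B -> vec n) :
  is_polytope P -> is_linear L ->
  (forall y, Q y <-> exists x, P x /\ forall i, L x i = y i) ->
  (forall F, is_facet P F ->
     exists j, (j < k)%coq_nat /\ forall x, F x <-> Fs j x) ->
  (forall a, is_linear_functional (f a)) ->
  (forall a y, Q y -> f a y <= beta a) ->
  (forall a, exists y, Q y /\ f a y = beta a) ->
  (forall b, Q (q b)) ->
  exists (X : nat -> A -> Prop) (Y : nat -> B -> Prop),
    (forall j a b, X j a -> Y j b -> f a (q b) < beta a) /\
    (forall a b, f a (q b) < beta a -> exists j : nat, [/\ (j < k)%N, X j a & Y j b]).
Proof.
move=> polyP [LD LZ] QE FsP lf fQ tight Qq.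
have lift y : Q y -> exists2 x, P x & L x = y.
  by move=> /QE [x [Px Lx]]; exists x => //; apply: functional_extensionality.
have PQ x : P x -> Q (L x) by move=> Px; apply/QE; exists x.
exists (fun j a => forall x, P x -> f a (L x) = beta a -> Fs j x).
exists (fun j b => exists x, [/\ P x, L x = q b & ~ Fs j x]).
split=> [j a b Xa [x [Px Lx Fx]]|a b fab].
  case: (Rle_lt_or_eq_dec _ _ (fQ a _ (Qq b))) => // fab.
  by case: Fx; apply: Xa; rewrite ?Lx.
have [p Pp Lp] := lift _ (Qq b).
(* Pulled back along [L], [f a] cuts out a face of [P], nonempty by [tight]; a facet containing it
   and missing [p] names the rectangle. *)
have [|x Px||||G [facetG fG Gp]] :=
  @polytope_facet_separation m P (fun x => f a (L x)) (beta a) p polyP.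
- have [fD fZ] := lf a; split=> [x y|t x].
    by rewrite -fD; congr (f a _); apply: functional_extensionality => i; apply: LD.
  by rewrite -fZ; congr (f a _); apply: functional_extensionality => i; apply: LZ.
- exact/fQ/PQ.
- have [y [/lift [x Px <-] fy]] := tight a.
  by exists x.
- by [].
- by rewrite Lp.
have [j [/ltP jk GE]] := FsP G facetG.
exists j; split=> // [x Px fx|]; first exact/GE/fG.
by exists p; split=> // /GE.
Qed.

(** * Rectangle covers of unique disjointness *)

(** The default [false] admits strings of any length, so no length conditions arise. *)
Definition overlap (k : nat) (a b : seq bool) : nat :=
  (\sum_(i < k) (nth false a i && nth false b i))%N.

Lemma overlap_cons k s t a b :
  overlap k.+1 (s :: a) (t :: b) = ((s && t) + overlap k a b)%N.
Proof. by rewrite /overlap big_ord_recl. Qed.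

(* The sum of w a b over all pairs of bit strings of length k with disjoint supports. *)
Fixpoint disj_sum (k : nat) (w : seq bool -> seq bool -> nat) : nat :=
  if k is l.+1 then
    disj_sum l (fun a b => w (false :: a) (false :: b) + w (true :: a) (false :: b)
                           + w (false :: a) (true :: b))%N
  else w [::] [::].

Lemma leq_disj_sum k w1 w2 :
  (forall a b, overlap k a b = 0%N -> (w1 a b <= w2 a b)%N) ->
  (disj_sum k w1 <= disj_sum k w2)%N.
Proof.
elim: k w1 w2 => [|k IHk] w1 w2 w12 /=; first by apply: w12; rewrite /overlap big_ord0.
by apply: IHk => a b ab; rewrite !leq_add // w12 // overlap_cons ab.
Qed.

Lemma disj_sum_sum k N (w : nat -> seq bool -> seq bool -> nat) :
  (disj_sum k (fun a b => \sum_(j < N) w j a b) = \sum_(j < N) disj_sum k (w j))%N.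
Proof.
elim: k w => //= k IHk w.
rewrite -(IHk (fun j a b => w j (false :: a) (false :: b) +
  w j (true :: a) (false :: b) + w j (false :: a) (true :: b))%N).
apply/eqP; rewrite eqn_leq !leq_disj_sum // => a b _; by rewrite !big_split.
Qed.

Lemma disj_sum_const k c : disj_sum k (fun _ _ => c) = (c * 3 ^ k)%N.
Proof.
elim: k c => [|k IHk] c /=; first by rewrite muln1.
by rewrite IHk expnS; lia.
Qed.

(* If the first bits are split off, (X0 u X1) x Y0 and X0 x (Y0 u Y1) again avoid
   overlap 1; a disjoint pair never lies in X1 x Y1, so these two rectangles
   dominate X0 x Y0, X1 x Y0 and X0 x Y1 together. *)
Lemma disj_sum_rectangle k (X Y : pred (seq bool)) :
  (forall a b, X a -> Y b -> overlap k a b <> 1%N) ->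
  (disj_sum k (fun a b => X a && Y b) <= 2 ^ k)%N.
Proof.
elim: k X Y => [|k IHk] X Y XY /=; first by case: (_ && _).
pose U (j : nat) a := X (false :: a) || (j == 0)%N && X (true :: a).
pose V (j : nat) b := Y (false :: b) || (j != 0)%N && Y (true :: b).
have -> : (2 ^ k.+1 = \sum_(j < 2) 2 ^ k)%N.
  by rewrite sum_nat_const card_ord expnS.
apply: (@leq_trans (\sum_(j < 2) disj_sum k (fun a b => U j a && V j b))).
  rewrite -(disj_sum_sum k 2 (fun j a b => U j a && V j b : nat)).
  apply: leq_disj_sum => a b ab; rewrite !big_ord_recl big_ord0 /U /V /=.
  have : ~~ (X (true :: a) && Y (true :: b)).
    by apply/negP => /andP [Xa /(XY _ _ Xa)]; rewrite overlap_cons ab.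
  by case: (X (false :: a)); case: (X (true :: a)); case: (Y (false :: b)); case: (Y (true :: b)).
apply: leq_sum => j _; apply: IHk => a b Ua Vb.
(* Both rectangles come from leading bits that are not both [true], so the tails have the same
   overlap as the full strings. *)
have [] : (exists s t, [/\ X (s :: a), Y (t :: b) & ~~ (s && t)]).
  move: Ua Vb; rewrite /U /V; case: eqP => _ /=; rewrite ?orbF.
    by move=> /orP [] ? ?; [exists false, false|exists true, false].
  by move=> ? /orP [] ?; [exists false, false|exists false, true].
move=> s [t [Xa Yb /negbTE st]].
by have := XY _ _ Xa Yb; rewrite overlap_cons st.
Qed.

(** Each of the [3 ^ k] disjoint pairs is counted in some rectangle, and each rectangle counts at
    most [2 ^ k] of them. Excluded middle turns the rectangles into boolean predicates for this
    count. *)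
Lemma disjointness_cover_bound k N (X Y : nat -> seq bool -> Prop) :
  (forall j a b, X j a -> Y j b -> overlap k a b <> 1%N) ->
  (forall a b, overlap k a b = 0%N -> exists j : nat, [/\ (j < N)%N, X j a & Y j b]) ->
  (3 ^ k <= N * 2 ^ k)%N.
Proof.
move=> XY cover.
pose dec (Q : Prop) : bool := if excluded_middle_informative Q then true else false.
have decP Q : reflect Q (dec Q) by rewrite /dec; case: excluded_middle_informative => ?; constructor.
rewrite -(mul1n (3 ^ k)%N) -disj_sum_const.
apply: (@leq_trans (disj_sum k (fun a b => \sum_(j < N) (dec (X j a) && dec (Y j b))))).
  apply: leq_disj_sum => a b /cover [j [jN /decP Xa /decP Yb]].
  by rewrite (bigD1 (Ordinal jN)) //= Xa Yb.
rewrite (disj_sum_sum k N (fun j a b => dec (X j a) && dec (Y j b) : nat)).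
rewrite -[N in (_ <= N * _)%N]card_ord -sum_nat_const; apply: leq_sum => j _.
by apply: disj_sum_rectangle => a b /decP Xa /decP; apply: XY.
Qed.

(** * Finite sums of reals *)

HB.instance Definition _ := Monoid.isComLaw.Build R 0 Rplus
  (fun x y z => esym (Rplus_assoc x y z)) Rplus_comm Rplus_0_l.
HB.instance Definition _ := Monoid.isMulLaw.Build R 0 Rmult Rmult_0_l Rmult_0_r.
HB.instance Definition _ := Monoid.isAddLaw.Build R Rmult Rplus
  Rmult_plus_distr_r Rmult_plus_distr_l.

Local Notation "\rsum_ i F" := (\big[Rplus/0]_i F) (at level 41, F at level 41, i at level 0).

Definition b2R (b : bool) : R := if b then 1 else 0.

Lemma rsum_le {I : finType} (F G : I -> R) :
  (forall i, F i <= G i) -> \rsum_i F i <= \rsum_i G i.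
Proof.
by move=> FG; apply: (big_ind2 Rle) => [|????|i _]; [lra|apply: Rplus_le_compat|].
Qed.

Lemma linear_rsum {I : finType} {m} (F : I -> vec m -> R) :
  (forall i, is_linear_functional (F i)) ->
  is_linear_functional (fun x => \rsum_i F i x).
Proof.
move=> lF; split=> [x y|t x].
  by rewrite -big_split; apply: eq_bigr => i _; rewrite (lF i).1.
by rewrite big_distrr; apply: eq_bigr => i _; rewrite (lF i).2.
Qed.

Lemma rsum_b2R {I : finType} (F : I -> bool) :
  \rsum_i b2R (F i) = INR (\sum_i F i)%N.
Proof.
rewrite (big_morph INR plus_INR (erefl : INR 0 = 0)).
by apply: eq_bigr => i _; case: (F i).
Qed.

(** * The 2-CNF formula and its slack matrix *)

Section Formula.
Variables (I : finType) (n : nat).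
Hypothesis le_n : (#|{: I + I * I}| <= n)%N.

(** [inl i] stands for [y_i] and [inr (i, j)] for [u_ij]; coordinates outside the range of [var]
    occur in no clause, which allows any large enough [n]. *)
Definition var (t : I + I * I) : 'I_n := widen_ord le_n (enum_rank t).

Lemma var_inj : injective var.
Proof. by move=> s t /(congr1 val) /= /val_inj /enum_rank_inj. Qed.

Definition pair_formula : cnf n :=
  [seq [:: (var (inr ij), false); (var (inl ij.1), true)] | ij : I * I] ++
  [seq [:: (var (inr ij), false); (var (inl ij.2), false)] | ij : I * I].

Lemma pair_formula_2cnf : is_2cnf pair_formula.
Proof. by rewrite /is_2cnf all_cat !all_map !(eq_all (a2 := predT)) ?all_predT. Qed.

Lemma pair_formulaP (a : 'I_n -> bool) :
  reflect (forall i j, a (var (inr (i, j))) -> a (var (inl i)) && ~~ a (var (inl j)))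
          (satisfies a pair_formula).
Proof.
rewrite /satisfies all_cat; apply: (iffP andP) => [[/allP h1 /allP h2] i j aij|h].
  have := h1 _ (image_f _ (isT : (i, j) \in predT)).
  have := h2 _ (image_f _ (isT : (i, j) \in predT)).
  by rewrite /= /lit_holds /= aij; case: (a _); case: (a _).
by split; apply/allP => c /imageP [[i j] _ ->]; have := h i j; rewrite /= /lit_holds /=;
  case: (a (var (inr _))) => //= /(_ isT); case: (a _); case: (a _).
Qed.

(* The correlation inequality [2 s - s^2 <= 1], [s = \sum_i alpha_i x_i], with
   each product [x_i x_j] replaced by its upper bound [x_i - u_ij]. *)
Definition cut (alpha : I -> bool) (x : vec n) : R :=
  2 * (\rsum_i (b2R (alpha i) * x (var (inl i)))) +
  -1 * \rsum_i \rsum_j (b2R (alpha i) * b2R (alpha j) *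
                    (x (var (inl i)) - x (var (inr (i, j))))).

Lemma cut_linear alpha : is_linear_functional (cut alpha).
Proof.
apply: (linear_functional_comb 2 (-1)); apply: linear_rsum => i.
  by split=> *; rewrite /vadd /vscale; ring.
by apply: linear_rsum => j; split=> *; rewrite /vadd /vscale; ring.
Qed.

Lemma rsum_sqr (alpha a : I -> bool) :
  \rsum_i \rsum_j (b2R (alpha i) * b2R (alpha j) * (b2R (a i) * b2R (a j))) =
  (\rsum_i (b2R (alpha i) * b2R (a i))) * (\rsum_i (b2R (alpha i) * b2R (a i))).
Proof.
rewrite big_distrl; apply: eq_bigr => i _; rewrite big_distrr.
by apply: eq_bigr => j _; rewrite /=; ring.
Qed.

(** The coefficients are nonnegative and the clauses give [y_i - u_ij >= y_i * y_j], so the double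
    sum is at least [s * s] and the cut at most [1 - (1 - s)^2]. *)
Lemma cut_le_on_sat alpha (a : 'I_n -> bool) (x : vec n) :
  satisfies a pair_formula -> (forall i, x i = b2R (a i)) -> cut alpha x <= 1.
Proof.
move=> /pair_formulaP sat_a xE.
pose y i := a (var (inl i)).
set s := \rsum_i (b2R (alpha i) * b2R (y i)).
have -> : cut alpha x = 2 * s + -1 * \rsum_i \rsum_j (b2R (alpha i) * b2R (alpha j) *
                    (x (var (inl i)) - x (var (inr (i, j))))).
  by rewrite /cut; congr (_ * _ + _); apply: eq_bigr => i _; rewrite xE.
have : s * s <= \rsum_i \rsum_j (b2R (alpha i) * b2R (alpha j) *
                    (x (var (inl i)) - x (var (inr (i, j))))).
  rewrite -rsum_sqr; apply: rsum_le => i; apply: rsum_le => j.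
  apply: Rmult_le_compat_l.
    by apply: Rmult_le_pos; rewrite /b2R; case: (alpha _); lra.
  rewrite !xE /y; have := sat_a i j; case: (a (var (inr _))) => [/(_ isT)|_].
    by case: (a _); case: (a _) => //= _; lra.
  by case: (a _); case: (a _) => /=; lra.
have := Rle_0_sqr (1 - s); rewrite /Rsqr; lra.
Qed.

(** Each [u_ij] gets the largest value its clauses allow, so that [y_i - u_ij = y_i * y_j]. *)
Definition canonical_assignment (y : I -> bool) (v : 'I_n) : bool :=
  match [pick t | var t == v] with
  | Some (inl i) => y i
  | Some (inr (i, j)) => y i && ~~ y j
  | None => false
  end.

Lemma canonical_assignmentE y t : canonical_assignment y (var t) =
  match t with inl i => y i | inr (i, j) => y i && ~~ y j end.
Proof.
rewrite /canonical_assignment; case: pickP => [s /eqP /var_inj -> //|/(_ t)].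
by rewrite eqxx.
Qed.

Lemma canonical_assignment_sat y : satisfies (canonical_assignment y) pair_formula.
Proof. by apply/pair_formulaP => i j; rewrite !canonical_assignmentE. Qed.

Lemma cut_canonical (alpha y : I -> bool) :
  cut alpha (fun v => b2R (canonical_assignment y v)) =
  1 - Rsqr (1 - INR (\sum_i (alpha i && y i))).
Proof.
have sE : \rsum_i (b2R (alpha i) * b2R (y i)) = INR (\sum_i (alpha i && y i)).
  rewrite -rsum_b2R; apply: eq_bigr => i _.
  by case: (alpha i); case: (y i) => /=; ring.
rewrite /cut (eq_bigr (fun i => b2R (alpha i) * b2R (y i))); last first.
  by move=> i _; rewrite canonical_assignmentE.
rewrite [X in -1 * X](eq_bigr (fun i => \rsum_j
    (b2R (alpha i) * b2R (alpha j) * (b2R (y i) * b2R (y j))))); last first.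
  move=> i _; apply: eq_bigr => j _; rewrite !canonical_assignmentE.
  by case: (y i); case: (y j) => /=; ring.
by rewrite rsum_sqr sE /Rsqr; ring.
Qed.

End Formula.

(** * The lower bound and its asymptotic form *)

Lemma xc_ge_pair_formula (k n : nat) (le_n : (#|{: 'I_k.+1 + 'I_k.+1 * 'I_k.+1}| <= n)%N)
    (N : R) : N * 2 ^ k <= 3 ^ k -> xc_ge (sat_polytope (pair_formula le_n)) N.
Proof.
move=> hN m P L polyP linL QE N' Fs FsP.
pose bits (a : seq bool) (i : 'I_k.+1) := nth false a i.
pose point (b : seq bool) : vec n := fun v => b2R (canonical_assignment le_n (bits b) v).
have point_in b : sat_polytope (pair_formula le_n) (point b).
  move=> C _; apply; exists (canonical_assignment le_n (bits b)).
  by split; first exact: canonical_assignment_sat.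
have cutE a b : cut le_n (bits a) (point b) = 1 - Rsqr (1 - INR (overlap k.+1 a b)).
  exact: cut_canonical.
(* The extra first bit makes every row inequality tight at the point [:: true],
   even for the empty set. *)
have [||b|b|X [Y [XY cover]]] := @extension_rectangle_cover _ _ _ P L N' Fs
    (seq bool) (seq bool) (fun a => cut le_n (bits (true :: a))) (fun=> 1)
    (fun b => point (false :: b)) polyP linL QE FsP.
- by move=> a; apply: cut_linear.
- move=> a y; apply: conv_hull_le; first exact: cut_linear.
  by move=> z [t [sat_t zE]]; apply: (cut_le_on_sat _ sat_t zE).
- exists (point [:: true]); split; first exact: point_in.
  rewrite cutE overlap_cons /overlap big1 => [|i _]; last by rewrite nth_nil andbF.
  by rewrite /Rsqr /=; ring.
- exact: point_in.
(* The slack is 1 at overlap 0 and 0 at overlap 1, so disjoint pairs are covered and pairs of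
   overlap 1 avoided. *)
have : (3 ^ k <= N' * 2 ^ k)%N.
  apply: (@disjointness_cover_bound k N' X Y) => [j a b Xa Yb ab|a b ab].
    have := XY _ _ _ Xa Yb; rewrite cutE overlap_cons ab /Rsqr /=; lra.
  by apply: cover; rewrite cutE overlap_cons ab /Rsqr /=; lra.
have INR_exp c : INR (c ^ k)%N = INR c ^ k.
  by elim: (k) => // l IHl; rewrite expnS mult_INR IHl.
move=> /leP /le_INR; rewrite mult_INR !INR_exp => le3.
have p2 : 0 < 2 ^ k by apply: pow_lt; lra.
apply: (Rmult_le_reg_r (2 ^ k)) => //; apply: (Rle_trans _ _ _ hN).
by move: le3; rewrite /INR; have -> : 1 + 1 + 1 = 3 by ring.
Qed.


Theorem theorem6 :
  exists c : R, 0 < c /\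
  exists n0 : nat, forall n : nat, (n0 <= n)%coq_nat ->
    exists phi : cnf n, is_2cnf phi /\
      xc_ge (sat_polytope phi) (Rpower 2 (c * sqrt (sqrt (INR n)))).
Proof.
(* With the fourth root of [n] at most [4 * k], the exponent is at most [k / 2], and
   [sqrt 2 <= 3 / 2]. *)
exists (1 / 8); split; first lra.
exists 9%N => n /leP n9.
(* With [s] the integer square root, [k + 1 = s - 1] fits because [s * (s - 1) <= n]; [n >= 9] gives
   [s >= 3], so [k >= 1] and [k + 3 <= 4 * k]. *)
have [k [k1 [le_n n_lt]]] : exists k, (1 <= k)%N /\
    ((k.+1 + k.+1 * k.+1 <= n) /\ (n < (k + 3) * (k + 3)))%N.
  have := Nat.sqrt_spec n (Nat.le_0_l n); set s := Nat.sqrt n => hs.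
  exists (s - 2)%N; nia.
have le_n' : (#|{: 'I_k.+1 + 'I_k.+1 * 'I_k.+1}| <= n)%N by rewrite card_sum card_prod card_ord.
exists (pair_formula le_n'); split; first exact: pair_formula_2cnf.
apply: xc_ge_pair_formula.
have k1R : 1 <= INR k by apply: (le_INR 1); apply/leP.
have nR : 1 <= INR n by apply: (le_INR 1); apply/leP; lia.
have n_le : INR n <= (4 * INR k) * (4 * INR k).
  have -> : 4 = INR 4 by rewrite /=; ring.
  by rewrite -!mult_INR; apply: le_INR; nia.
have sqrt_le : sqrt (INR n) <= 4 * INR k.
  by rewrite -(sqrt_square (4 * INR k)); [apply: sqrt_le_1_alt|lra].
(* The outer root is given away: [sqrt (INR n)] itself satisfies this bound. *)
have sqrt2_le : sqrt (sqrt (INR n)) <= 4 * INR k.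
  rewrite -(sqrt_square (4 * INR k)); last lra.
  by apply: sqrt_le_1_alt; nra.
apply: (Rle_trans _ ((3 / 2) ^ k * 2 ^ k)); last first.
  by rewrite -Rpow_mult_distr; apply: Req_le; congr (_ ^ _); field.
apply: Rmult_le_compat_r; first by apply: pow_le; lra.
apply: (Rle_trans _ (Rpower 2 (/ 2 * INR k))).
  by apply: Rle_Rpower; lra.
rewrite -Rpower_mult Rpower_pow; last exact: exp_pos.
apply: pow_incr; split; first by apply: Rlt_le; apply: exp_pos.
rewrite Rpower_sqrt; last lra.
rewrite -(sqrt_square (3 / 2)); last lra.
by apply: sqrt_le_1_alt; lra.
Qed.
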